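(* Let $(\widetilde{M},\widetilde{g},\widetilde{\nabla},F)$ be a locally product-like statistical manifold whose curvature tensor satisfies, for some constant $\widetilde{c}$ and all vector fields $X,Y,Z$ on $\widetilde{M}$, $$\widetilde{R}(X,Y)Z=\widetilde{c}\,[\widetilde{g}(Y,Z)X-\widetilde{g}(X,Z)Y+\widetilde{g}(Y,FZ)FX-\widetilde{g}(X,FZ)FY+\{\widetilde{g}(FX,Y)-\widetilde{g}(X,FY)\}FZ].$$ Let $(M,g)$ be a tangential hypersurface of $\widetilde{M}$. If $M$ is totally geodesic with respect to $\widetilde{\nabla}$, then $\widetilde{M}$ is flat.
   Context: A statistical manifold $(\widetilde{M},\widetilde{g},\widetilde{\nabla})$ is a Riemannian manifold with a torsion-free affine connection $\widetilde{\nabla}$ such that $\widetilde{\nabla}\widetilde{g}$ is symmetric. A locally product-like statistical manifold $(\widetilde{M},\widetilde{g},\widetilde{\nabla},F)$ is a statistical manifold with a $(1,1)$-tensor field $F$ satisfying $F^{2}=I$, $F\neq\pm I$ and $\widetilde{\nabla}F=0$, together with the $(1,1)$-tensor field $F^{\ast}$ satisfying $\widetilde{g}(FX,Y)=\widetilde{g}(X,F^{\ast}Y)$. $\widetilde{R}(X,Y)Z=\widetilde{\nabla}_{X}\widetilde{\nabla}_{Y}Z-\widetilde{\nabla}_{Y}\widetilde{\nabla}_{X}Z-\widetilde{\nabla}_{[X,Y]}Z$ is the curvature tensor of $\widetilde{\nabla}$; $\widetilde{M}$ is called flat if $\widetilde{R}$ vanishes identically. A hypersurface $(M,g)$ (induced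 metric $g$, unit normal vector field $N$) is tangential if $FN$ and $F^{\ast}N$ are tangent to $M$. For $X,Y\in\Gamma(TM)$ write $\widetilde{\nabla}_{X}Y=\nabla_{X}Y+{}'\sigma(X,Y)N$ with $\nabla_{X}Y$ tangent to $M$; $M$ is totally geodesic with respect to $\widetilde{\nabla}$ if ${}'\sigma=0$.
   Formalization: The ambient manifold is additionally assumed to have dimension at least 3 (the hypersurface at least 2), because the claim fails for surfaces with a geodesic curve; the hypersurface is assumed nonempty. *)

(* Defs.v *)
(* MathComp-Analysis; the reals are an arbitrary [R : realType]. *)
From HB Require Import structures.
From mathcomp Require Import all_boot all_order all_algebra.
From mathcomp Require Import all_classical all_reals all_analysis.

Set Implicit Arguments.
Unset Strict Implicit.
Unset Printing Implicit Defensive.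

Import Order.TTheory GRing.Theory Num.Theory.
Import numFieldNormedType.Exports.

Local Open Scope classical_set_scope.
Local Open Scope ring_scope.

(* Meant for an open set [U], on which the directional derivatives only depend
   on the values of [f] in [U]. *)
Fixpoint Ck_on (R : realType) (V W : normedModType R) (k : nat) (U : set V)
    (f : V -> W) {struct k} : Prop :=
  match k with
  | 0%N => forall x, U x -> {for x, continuous f}
  | k'.+1 => (forall x, U x -> differentiable f x) /\
             (forall v : V, Ck_on k' U (fun x => 'D_v f x))
  end.

Definition smooth_on (R : realType) (V W : normedModType R) (U : set V)
    (f : V -> W) : Prop := forall k, Ck_on k U f.

(* A homeomorphism from the open set [dom] onto an open subset of R^n; outside
   [dom] and its image, [to_coord] and [of_coord] take junk values. *)
Record chart (R : realType) (T : topologicalType) (n : nat) := Chart {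
  dom : set T;
  to_coord : T -> 'rV[R]_n;
  of_coord : 'rV[R]_n -> T;
  dom_open : open dom;
  codom_open : open (to_coord @` dom);
  to_coordK : forall p, dom p -> of_coord (to_coord p) = p;
  to_coord_continuous : {within dom, continuous to_coord};
  of_coord_continuous : {within to_coord @` dom, continuous of_coord}
}.

Definition transition_smooth (R : realType) (T : topologicalType) (n : nat)
    (c d : chart R T n) : Prop :=
  smooth_on (to_coord c @` (dom c `&` dom d)) (to_coord d \o of_coord c).

(* [chart_at] selects a chart around each point. The tangent space at [p] is
   represented by 'rV[R]_n, a vector being identified with its components in
   [chart_at p]; thus a vector field on M is a function M -> 'rV[R]_n, and its
   values at different points are components in different charts. *)
Record manifold (R : realType) (n : nat) := Manifold {
  mcarrier :> topologicalType;
  manifold_hausdorff : hausdorff_space mcarrier;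
  manifold_second_countable : @second_countable mcarrier;
  atlas : set (chart R mcarrier n);
  atlas_smooth : forall c d, atlas c -> atlas d -> transition_smooth c d;
  chart_at : mcarrier -> chart R mcarrier n;
  chart_at_atlas : forall p, atlas (chart_at p);
  chart_at_dom : forall p, dom (chart_at p) p
}.

Section Manifold.
Variables (R : realType) (n : nat) (M : manifold R n).

Definition coord_at (p : M) : 'rV[R]_n := to_coord (chart_at p) p.

(* Membership in the maximal atlas. *)
Definition smooth_chart (c : chart R M n) : Prop :=
  forall d, atlas d -> transition_smooth c d /\ transition_smooth d c.

Definition smooth_fun (f : M -> R) : Prop :=
  forall c : chart R M n, atlas c ->
    smooth_on (to_coord c @` dom c) (f \o of_coord c).

(* The components in the chart [c] of the tangent vector [v] at [p]. *)
Definition components (c : chart R M n) (p : M) (v : 'rV[R]_n) : 'rV[R]_n :=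
  'D_v (to_coord c \o of_coord (chart_at p)) (coord_at p).

(* The function [X f]. *)
Definition vderiv (X : M -> 'rV[R]_n) (f : M -> R) (p : M) : R :=
  'D_(X p) (f \o of_coord (chart_at p)) (coord_at p).

(* [X, Y] = (DY) X - (DX) Y, computed at [p] in the chart [chart_at p]. *)
Definition lie_bracket (X Y : M -> 'rV[R]_n) (p : M) : 'rV[R]_n :=
  let local (Z : M -> 'rV[R]_n) (x : 'rV[R]_n) :=
    components (chart_at p) (of_coord (chart_at p) x)
               (Z (of_coord (chart_at p) x)) in
  'D_(X p) (local Y) (coord_at p) - 'D_(Y p) (local X) (coord_at p).

End Manifold.

Section Maps.
Variables (R : realType) (m n : nat) (M : manifold R m) (Mt : manifold R n).

(* The differential of [i] at [p], applied to [v]. *)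
Definition tangent_map (i : M -> Mt) (p : M) (v : 'rV[R]_m) : 'rV[R]_n :=
  'D_v (to_coord (chart_at (i p)) \o i \o of_coord (chart_at p)) (coord_at p).

(* [V p] is a tangent vector of [Mt] at [i p]. *)
Definition smooth_along (i : M -> Mt) (V : M -> 'rV[R]_n) : Prop :=
  forall (c : chart R M m) (d : chart R Mt n), atlas c -> atlas d ->
    smooth_on (to_coord c @` (dom c `&` i @^-1` dom d))
      (fun x => components d (i (of_coord c x)) (V (of_coord c x))).

End Maps.

Definition smooth_vfield (R : realType) (n : nat) (M : manifold R n)
    (X : M -> 'rV[R]_n) : Prop :=
  smooth_along (fun p : M => p) X.

(* A (0,2)-tensor field is given by its Gram matrices [g p], and a (1,1)-tensor
   field by matrices [F p] acting on row vectors from the right, both with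
   respect to [chart_at p]. *)
Section Tensors.
Variables (R : realType) (n : nat) (M : manifold R n).
Implicit Types (X Y Z : M -> 'rV[R]_n) (f : M -> R).
Implicit Types (g F : M -> 'M[R]_n).
Implicit Type D : (M -> 'rV[R]_n) -> (M -> 'rV[R]_n) -> (M -> 'rV[R]_n).

Definition inner g (p : M) (u v : 'rV[R]_n) : R := (u *m g p *m v^T) 0 0.

Definition inner_fun g X Y (p : M) : R := inner g p (X p) (Y p).

Definition tensor_app F X (p : M) : 'rV[R]_n := X p *m F p.

Record riemannian_metric g : Prop := RiemannianMetric {
  metric_sym : forall p u v, inner g p u v = inner g p v u;
  metric_pos : forall p u, u != 0 -> 0 < inner g p u u;
  metric_smooth : forall X Y, smooth_vfield X -> smooth_vfield Y ->
    smooth_fun (inner_fun g X Y)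
}.

Definition smooth_endo F : Prop :=
  forall X, smooth_vfield X -> smooth_vfield (tensor_app F X).

(* [D X Y] is the covariant derivative of [Y] along [X]; only its values on
   smooth vector fields are constrained. *)
Record affine_connection D : Prop := AffineConnection {
  connection_smooth : forall X Y, smooth_vfield X -> smooth_vfield Y ->
    smooth_vfield (D X Y);
  connection_addl : forall X1 X2 Y,
    smooth_vfield X1 -> smooth_vfield X2 -> smooth_vfield Y ->
    forall p, D (fun q => X1 q + X2 q) Y p = D X1 Y p + D X2 Y p;
  connection_scalel : forall f X Y,
    smooth_fun f -> smooth_vfield X -> smooth_vfield Y ->
    forall p, D (fun q => f q *: X q) Y p = f p *: D X Y p;
  connection_addr : forall X Y1 Y2,
    smooth_vfield X -> smooth_vfield Y1 -> smooth_vfield Y2 ->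
    forall p, D X (fun q => Y1 q + Y2 q) p = D X Y1 p + D X Y2 p;
  connection_leibniz : forall f X Y,
    smooth_fun f -> smooth_vfield X -> smooth_vfield Y ->
    forall p, D X (fun q => f q *: Y q) p
              = vderiv X f p *: Y p + f p *: D X Y p
}.

Definition torsion_free D : Prop :=
  forall X Y, smooth_vfield X -> smooth_vfield Y ->
  forall p, D X Y p - D Y X p = lie_bracket X Y p.

(* (D_X g)(Y, Z) *)
Definition cov_metric D g X Y Z (p : M) : R :=
  vderiv X (inner_fun g Y Z) p
  - inner g p (D X Y p) (Z p) - inner g p (Y p) (D X Z p).

(* (D_X F) Y *)
Definition cov_endo D F X Y (p : M) : 'rV[R]_n :=
  D X (tensor_app F Y) p - tensor_app F (D X Y) p.

(* The tensor [cov_metric D g] being symmetric in its last two arguments, the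
   last clause makes it totally symmetric. *)
Definition statistical_manifold g D : Prop :=
  [/\ riemannian_metric g, affine_connection D, torsion_free D &
      forall X Y Z, smooth_vfield X -> smooth_vfield Y -> smooth_vfield Z ->
      forall p, cov_metric D g X Y Z p = cov_metric D g Y X Z p].

Record product_like_statistical_manifold g D F (Fs : M -> 'M[R]_n) : Prop :=
    ProductLikeStatisticalManifold {
  pl_statistical : statistical_manifold g D;
  pl_smooth : smooth_endo F;
  pl_square : forall p, F p *m F p = 1%:M;
  pl_neq_id : F <> (fun => 1%:M);
  pl_neq_opp_id : F <> (fun => - 1%:M);
  pl_parallel : forall X Y, smooth_vfield X -> smooth_vfield Y ->
    forall p, cov_endo D F X Y p = 0;
  pl_adj_smooth : smooth_endo Fs;
  pl_adj : forall p u v, inner g p (u *m F p) v = inner g p u (v *m Fs p)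
}.

Definition curvature D X Y Z (p : M) : 'rV[R]_n :=
  D X (D Y Z) p - D Y (D X Z) p - D (lie_bracket X Y) Z p.

Definition flat D : Prop :=
  forall X Y Z, smooth_vfield X -> smooth_vfield Y -> smooth_vfield Z ->
  forall p, curvature D X Y Z p = 0.

Definition product_space_form g D F (c : R) : Prop :=
  forall X Y Z, smooth_vfield X -> smooth_vfield Y -> smooth_vfield Z ->
  forall p,
    let gp := inner g p in
    let x := X p in let y := Y p in let z := Z p in
    let Fx := tensor_app F X p in
    let Fy := tensor_app F Y p in
    let Fz := tensor_app F Z p in
    curvature D X Y Z p =
      c *: (gp y z *: x - gp x z *: y + gp y Fz *: Fx - gp x Fz *: Fy
            + (gp Fx y - gp x Fy) *: Fz).

End Tensors.

Section Hypersurface.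
Variables (R : realType) (n : nat) (M : manifold R n) (Mt : manifold R n.+1).
Variables (gt : Mt -> 'M[R]_n.+1)
  (D : (Mt -> 'rV[R]_n.+1) -> (Mt -> 'rV[R]_n.+1) -> (Mt -> 'rV[R]_n.+1)).
Variables (i : M -> Mt) (N : M -> 'rV[R]_n.+1).

(* Immersion in the sense of Lang: in suitable charts of the maximal atlases,
   [i] is x |-> (0, x). Embedded hypersurfaces (M a subset of Mt with adapted
   charts, [i] the inclusion) are a special case. *)
Definition immersed_hypersurface : Prop :=
  forall p : M, exists (c : chart R M n) (d : chart R Mt n.+1),
    [/\ smooth_chart c, smooth_chart d, dom c p, i @` dom c `<=` dom d &
        forall q, dom c q ->
          to_coord d (i q) = row_mx (0 : 'rV[R]_1) (to_coord c q)].

(* [v] is a tangent vector of [Mt] at [i p]. *)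
Definition tangent_to (p : M) (v : 'rV[R]_n.+1) : Prop :=
  exists w : 'rV[R]_n, v = tangent_map i p w.

Record hypersurface (g : M -> 'M[R]_n) : Prop := Hypersurface {
  hyp_nonempty : [set: M] !=set0;
  hyp_immersed : immersed_hypersurface;
  hyp_metric : forall p u v,
    inner g p u v = inner gt (i p) (tangent_map i p u) (tangent_map i p v);
  hyp_normal_smooth : smooth_along i N;
  hyp_normal : forall p u, inner gt (i p) (N p) (tangent_map i p u) = 0;
  hyp_unit : forall p, inner gt (i p) (N p) (N p) = 1
}.

Definition tangential (F Fs : Mt -> 'M[R]_n.+1) : Prop :=
  forall p, tangent_to p (N p *m F (i p)) /\ tangent_to p (N p *m Fs (i p)).

(* The vector field [Xt] on [Mt] extends the vector field [X] on M near [p]. *)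
Definition extends_near (p : M) (X : M -> 'rV[R]_n) (Xt : Mt -> 'rV[R]_n.+1)
    : Prop :=
  \forall q \near p, Xt (i q) = tangent_map i q (X q).

(* [s] is the value at [p] of the coefficient of [N] in the decomposition of
   [D X Y] into a tangential and a normal part, [D X Y] being computed at [p]
   with arbitrary local extensions of [X] and [Y]. *)
Definition second_form (X Y : M -> 'rV[R]_n) (p : M) (s : R) : Prop :=
  exists Xt Yt : Mt -> 'rV[R]_n.+1,
    [/\ smooth_vfield Xt, smooth_vfield Yt,
        extends_near p X Xt, extends_near p Y Yt &
        tangent_to p (D Xt Yt (i p) - s *: N p)].

Definition totally_geodesic : Prop :=
  forall X Y : M -> 'rV[R]_n, smooth_vfield X -> smooth_vfield Y ->
  forall p s, second_form X Y p s -> s = 0.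

End Hypersurface.

(* Main.v *)
(* Covariant derivatives of fields tangent to M along M are again tangent to M,
   because 'sigma = 0; hence so is R(X, Y)Z for tangent X, Y, Z. Write
   eta = F* N, a nonzero tangent vector, so that <FX, N> = <X, eta>. If c were
   nonzero, the vanishing of <R(X, eta)Z, N> for X, Z tangent and orthogonal to
   eta would give <X, FZ> = 0. The dimension being at least 3, there is such an
   X <> 0; FX is tangent and orthogonal to all such vectors, so FX = a eta and
   X = a F eta, whence 0 = <X, N> = a <eta, eta>, a = 0 and X = 0, a
   contradiction. The curvature is evaluated on global fields cut off by bump
   functions. *)
From HB Require Import structures.
Require Import Defs.
From mathcomp Require Import all_boot all_order all_algebra.
From mathcomp Require Import all_classical all_reals all_analysis.
From mathcomp Require Import ring lra.

Set Implicit Arguments.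
Unset Strict Implicit.
Unset Printing Implicit Defensive.

Import Order.TTheory GRing.Theory Num.Theory.
Import numFieldNormedType.Exports.

Local Open Scope classical_set_scope.
Local Open Scope ring_scope.

(** * Smooth maps between normed modules *)

Section Calculus.
Variable R : realType.
Implicit Types V W Z : normedModType R.

(** A first-order expansion at [x] only involves values near [x], so the one of [f] serves for [g];
    uniqueness of the differential then identifies ['d g x] with ['d f x]. *)
Lemma near_eq_differentiable V W (f g : V -> W) (x : V) :
  (\near x, f x = g x) -> differentiable f x -> differentiable g x.
Proof.
move=> fg df; have fgx : f x = g x := nbhs_singleton fg.
have [[dfc _]] := df.
have H : g \o shift x = cst (g x) + 'd f x +o_ 0 id.
  have := diff_locally df; move/eqaddoP => fo.
  apply/eqaddoP => e e0; have := fo e e0; apply: filter_app.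
  have : \forall y \near 0, f (y + x) = g (y + x).
    move: fg; rewrite (near_shift 0 x)/=; apply: filterS => y /=.
    by rewrite subr0.
  apply: filterS => y fgy.
  by rewrite !fctE /= fgy fgx.
by apply/diff_locallyP; rewrite (diff_unique dfc H).
Qed.

Lemma derive_comp V W Z (g : V -> W) (f : W -> Z) (x v : V) :
  differentiable g x -> differentiable f (g x) ->
  'D_v (f \o g) x = 'D_('D_v g x) f (g x).
Proof.
move=> dg df; rewrite (deriveE _ df) (deriveE _ dg).
by rewrite (deriveE _ (differentiable_comp dg df)) diff_comp.
Qed.

Lemma derive_sum_dir V W (f : V -> W) (x : V) m (a : 'I_m -> R) (e : 'I_m -> V) :
  differentiable f x ->
  'D_(\sum_j a j *: e j) f x = \sum_j a j *: 'D_(e j) f x.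
Proof.
move=> df; rewrite deriveE// linear_sum; apply: eq_bigr => j _.
by rewrite linearZ deriveE.
Qed.

Lemma scale_is_bilinear W :
  bilinear_for
    (GRing.Scale.Law.clone _ _ *:%R _) (GRing.Scale.Law.clone _ _ *:%R _)
    (@GRing.scale R W : R -> W -> W).
Proof.
split=> [u'|u] a x y /=.
- by rewrite scalerDl scalerA.
- by rewrite scalerDr !scalerA mulrC.
Qed.

HB.instance Definition _ (W : normedModType R) := bilinear_isBilinear.Build R R W W _ _
  (@GRing.scale R W : R -> W -> W) (scale_is_bilinear W).

(** The product rule: scaling is a continuous bilinear map on [R * W], composed here with the pair
    [(f, g)]. *)
Lemma is_diff_scale V W (f df : V -> R) (g dg : V -> W) (x : V) :
  is_diff x f df -> is_diff x g dg ->
  is_diff x (fun y => f y *: g y) (fun y => f x *: dg y + df y *: g x).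
Proof.
move=> hf hg.
have sc p : is_diff p (fun q : R * W => q.1 *: q.2)
                      (fun q => p.1 *: q.2 + q.1 *: p.2).
  apply: DiffDef; last by rewrite diff_bilin // => ?; apply: scale_continuous.
  by apply: differentiable_bilin =>?; apply: scale_continuous.
exact: (@is_diff_comp _ _ _ _ (fun y => (f y, g y)) _ _ _ x _ (sc (f x, g x))).
Qed.

Lemma differentiable_scale V W (f : V -> R) (g : V -> W) (x : V) :
  differentiable f x -> differentiable g x ->
  differentiable (fun y => f y *: g y) x.
Proof.
move=> /differentiableP hf /differentiableP hg.
by have [] := is_diff_scale hf hg.
Qed.

Lemma derive_scale V W (f : V -> R) (g : V -> W) (x v : V) :
  differentiable f x -> differentiable g x ->
  'D_v (fun y => f y *: g y) x = f x *: 'D_v g x + 'D_v f x *: g x.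
Proof.
move=> df dg; rewrite !deriveE//; last exact: differentiable_scale.
by have [_ ->] := is_diff_scale (differentiableP df) (differentiableP dg).
Qed.

Lemma Ck_ext k V W (U : set V) (f g : V -> W) :
  (forall x, U x -> \near x, f x = g x) -> Ck_on k U f -> Ck_on k U g.
Proof.
elim: k f g => [|k IH] f g fg /=.
  move=> cf x Ux; have fgx := fg _ Ux.
  rewrite /prop_for /continuous_at -(nbhs_singleton fgx).
  by apply: cvg_trans (cf x Ux); exact: near_eq_cvg.
case=> df Df; split=> [x Ux|v].
  by apply: near_eq_differentiable (df x Ux); exact: fg.
(* Agreement near [x] is agreement near every [y] close to [x], hence the derivatives agree at all
   such [y]. *)
apply: IH (Df v) => x Ux; have := fg _ Ux; rewrite -!nbhs_nearE => fgx.
apply: filterS (nbhs_interior fgx) => y; exact: near_eq_derive.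
Qed.

Lemma Ck_sub k V W (A B : set V) (f : V -> W) :
  A `<=` B -> Ck_on k B f -> Ck_on k A f.
Proof.
move=> AB; elim: k f => [|k IH] f /=; first by move=> + x /AB; exact.
by case=> df Df; split=> [x /AB/df//|v]; exact: (IH _ (Df v)).
Qed.

Lemma CkW k V W (U : set V) (f : V -> W) : Ck_on k.+1 U f -> Ck_on k U f.
Proof.
elim: k f => [|k IH] f.
  by case=> df _ x /df; exact: differentiable_continuous.
by case=> df Df; split=> // v; exact: (IH _ (Df v)).
Qed.

Lemma Ck_cst k V W (U : set V) (a : W) : Ck_on k U (fun _ : V => a).
Proof.
elim: k a => [|k IH] a /=; first by move=> x _; exact: cst_continuous.
split=> [x _|v]; first exact: differentiable_cst.
by apply: Ck_ext (IH 0) => x _; near=> y; rewrite derive_cst.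
Unshelve. all: by end_near. Qed.

Lemma Ck_id k V (U : set V) : Ck_on k U (fun x : V => x).
Proof.
case: k => [|k] /=; first by move=> x _; exact: cvg_id.
split=> [x _|v]; first exact: ex_diff.
by apply: Ck_ext (Ck_cst _ _ v) => x _; near=> y; rewrite derive_id.
Unshelve. all: by end_near. Qed.

Lemma CkD k V W (U : set V) (f g : V -> W) : open U ->
  Ck_on k U f -> Ck_on k U g -> Ck_on k U (fun x => f x + g x).
Proof.
move=> oU; elim: k f g => [|k IH] f g /=.
  by move=> cf cg x Ux; apply: continuousD; [exact: cf|exact: cg].
move=> [df Df] [dg Dg]; split=> [x Ux|v].
  by apply: differentiableD; [exact: df|exact: dg].
apply: Ck_ext (IH _ _ (Df v) (Dg v)) => x Ux.
have : \forall y \near x, U y by exact: open_nbhs_nbhs.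
apply: filterS => y Uy; rewrite -deriveD//.
- exact/diff_derivable/df.
- exact/diff_derivable/dg.
Qed.

Lemma Ck_sum k V W (U : set V) m (f : 'I_m -> V -> W) : open U ->
  (forall j, Ck_on k U (f j)) -> Ck_on k U (fun x => \sum_j f j x).
Proof.
move=> oU; elim: m f => [|m IH] f hf.
  by apply: Ck_ext (Ck_cst k U 0) => x _; near=> y; rewrite big_ord0.
apply: (@Ck_ext _ _ _ _
  (fun x => \sum_(j < m) f (widen_ord (leqnSn m) j) x + f ord_max x)).
  by move=> x _; near=> y; rewrite big_ord_recr.
by apply: CkD => //; apply: IH.
Unshelve. all: by end_near. Qed.

Lemma Ck_linear k V W Z (U : set V) (L : {linear W -> Z}) (f : V -> W) :
  open U -> continuous L -> Ck_on k U f -> Ck_on k U (fun x => L (f x)).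
Proof.
move=> oU cL; elim: k f => [|k IH] f /=.
  move=> cf x Ux; apply: continuous_comp; [exact: cf|exact: cL].
move=> [df Df]; split=> [x Ux|v].
  apply: differentiable_comp; first exact: df.
  exact: linear_differentiable.
apply: Ck_ext (IH _ (Df v)) => x Ux.
have : \forall y \near x, U y by exact: open_nbhs_nbhs.
apply: filterS => y Uy; rewrite (derive_comp (f := L)) ?[RHS]deriveE//.
- by rewrite diff_lin.
- exact: linear_differentiable.
- exact: df.
- exact: linear_differentiable.
Qed.

Lemma Ck_scale k V W (U : set V) (f : V -> R) (g : V -> W) : open U ->
  Ck_on k U f -> Ck_on k U g -> Ck_on k U (fun x => f x *: g x).
Proof.
move=> oU; elim: k f g => [|k IH] f g.
  by move=> cf cg x Ux; apply: continuousZ; [exact: cf|exact: cg].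
move=> Cf Cg; have [df Df] := Cf; have [dg Dg] := Cg; split=> [x Ux|v].
  by apply: differentiable_scale; [exact: df|exact: dg].
apply: Ck_ext (CkD oU (IH _ _ (CkW Cf) (Dg v)) (IH _ _ (Df v) (CkW Cg))) => x Ux.
have : \forall y \near x, U y by exact: open_nbhs_nbhs.
apply: filterS => y Uy; rewrite derive_scale//; [exact: df|exact: dg].
Qed.

(** Finite-dimensionality in the form used below: a derivative in a direction that varies with the
    point becomes a finite sum of derivatives in the fixed directions [e j], with scalar
    coefficients. The [e j] need not be independent. *)
Definition has_coordinates W := exists m (e : 'I_m -> W)
  (l : 'I_m -> {linear W -> R}),
  (forall j, continuous (l j)) /\ (forall w, w = \sum_j l j w *: e j).

Definition rV_coord m (j : 'I_m) (x : 'rV[R]_m) : R := x 0 j.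

Lemma rV_coord_is_linear m (j : 'I_m) : linear (rV_coord j).
Proof. by move=> a x y; rewrite /rV_coord !mxE. Qed.

HB.instance Definition _ m (j : 'I_m) :=
  GRing.isLinear.Build R 'rV[R]_m R _ (rV_coord j) (rV_coord_is_linear j).

Lemma has_coordinates_rV m : has_coordinates 'rV[R]_m.
Proof.
exists m, (fun j => delta_mx 0 j), (fun j => rV_coord j).
by split=> [j|w]; [exact: coord_continuous|exact: row_sum_delta].
Qed.

Lemma has_coordinates_real : has_coordinates R.
Proof.
exists 1%N, (fun=> 1), (fun=> idfun); split=> [j|w]; first by move=> x.
by rewrite big_ord1 /= /GRing.scale /= mulr1.
Qed.

(** The chain rule differentiates [f] in the moving direction ['D_v g x]. Expanding this direction
    in coordinates leaves the functions ['D_(e j) f] composed with [g], to which the induction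
    hypothesis applies. *)
Lemma Ck_comp k V W Z (U : set V) (A : set W) (f : W -> Z) (g : V -> W) :
  has_coordinates W -> open U -> (forall x, U x -> A (g x)) ->
  Ck_on k A f -> Ck_on k U g -> Ck_on k U (fun x => f (g x)).
Proof.
move=> [m [e [l [lc le]]]] oU UA; elim: k f => [|k IH] f.
  move=> cf cg x Ux; apply: continuous_comp; first exact: cg.
  exact/cf/UA.
move=> Cf Cg; have [df Df] := Cf; have [dg Dg] := Cg; split=> [x Ux|v].
  by apply: differentiable_comp; [exact: dg|exact/df/UA].
have : Ck_on k U (fun x => \sum_j l j ('D_v g x) *: 'D_(e j) f (g x)).
  apply: Ck_sum => // j; apply: Ck_scale => //.
    by apply: Ck_linear => //; exact: Dg.
  by apply: (IH _ (Df _)); exact: CkW.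
apply: Ck_ext => x Ux.
have : \forall y \near x, U y by exact: open_nbhs_nbhs.
apply: filterS => y Uy; rewrite (derive_comp (f := f)); last 2 first.
- exact: dg.
- exact/df/UA.
by rewrite -derive_sum_dir -?le//; exact/df/UA.
Qed.

(** * Smoothness at a point and its closure properties *)

Definition smooth_at V W (f : V -> W) (x : V) :=
  exists2 U : set V, open_nbhs x U & smooth_on U f.

Lemma smooth_onP V W (U : set V) (f : V -> W) : open U ->
  smooth_on U f <-> forall x, U x -> smooth_at f x.
Proof.
move=> oU; split=> [sf x Ux|sf k]; first by exists U.
(* At every order [Ck_on] is a conjunction of conditions at single points, so it may be checked on
   singletons; the neighbourhoods given by [smooth_at] need not be glued. *)
have {}sf x : U x -> Ck_on k [set x] f.
  move=> /sf[A [oA Ax] /(_ k)]; apply: Ck_sub.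
  by move=> _ ->.
elim: k f sf => [|k IH] f sf /=; first by move=> x Ux; exact: (sf x Ux).
split=> [x Ux|v]; first by have [+ _] := sf x Ux; exact.
by apply: IH => x Ux; have [_] := sf x Ux; exact.
Qed.

Section SmoothAt.
Variables (V : normedModType R) (x : V).

Lemma smooth_at_near W (f : V -> W) :
  smooth_at f x -> \forall y \near x, smooth_at f y.
Proof.
by case=> U [oU Ux] sf; apply: filterS (open_nbhs_nbhs (conj oU Ux)) => y; exists U.
Qed.

Lemma smooth_at_differentiable W (f : V -> W) : smooth_at f x -> differentiable f x.
Proof. by case=> U [_ Ux] /(_ 1)[+ _]; exact. Qed.

Lemma smooth_at_continuous W (f : V -> W) : smooth_at f x -> {for x, continuous f}.
Proof. by move=> /smooth_at_differentiable; exact: differentiable_continuous. Qed.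

Lemma smooth_at_ext W (f g : V -> W) :
  (\near x, f x = g x) -> smooth_at f x -> smooth_at g x.
Proof.
move=> fg [U Ux sf].
have : \forall y \near x, U y /\ f y = g y.
  by near=> y; split; near: y => //; exact: open_nbhs_nbhs.
rewrite -nbhs_nearE nbhsE /= => -[A [oA Ax] AU]; exists A => // k.
have : Ck_on k A f by apply: Ck_sub (sf k) => y /AU[].
apply: Ck_ext => y Ay; apply: filterS (open_nbhs_nbhs (conj oA Ay)) => z.
by move=> /AU[].
Unshelve. all: by end_near. Qed.

Lemma smooth_at_cst W (a : W) : smooth_at (fun _ : V => a) x.
Proof. by exists setT; [split => //; exact: openT|move=> k; exact: Ck_cst]. Qed.

Lemma smooth_at_id : smooth_at (fun y : V => y) x.
Proof. by exists setT; [split => //; exact: openT|move=> k; exact: Ck_id]. Qed.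

Lemma open_nbhsI2 (A B : set V) : open_nbhs x A -> open_nbhs x B ->
  exists C, [/\ open_nbhs x C, C `<=` A & C `<=` B].
Proof.
move=> [oA Ax] [oB Bx]; exists (A `&` B); split; first by split; [exact: openI|].
- exact: subIsetl.
- exact: subIsetr.
Qed.

Lemma smooth_atD W (f g : V -> W) :
  smooth_at f x -> smooth_at g x -> smooth_at (fun y => f y + g y) x.
Proof.
move=> [A Ax sf] [B Bx sg]; have [C [Cx CA CB]] := open_nbhsI2 Ax Bx.
exists C => // k; apply: CkD; first by have [] := Cx.
- exact: Ck_sub (sf k).
- exact: Ck_sub (sg k).
Qed.

Lemma smooth_atZ W (f : V -> R) (g : V -> W) :
  smooth_at f x -> smooth_at g x -> smooth_at (fun y => f y *: g y) x.
Proof.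
move=> [A Ax sf] [B Bx sg]; have [C [Cx CA CB]] := open_nbhsI2 Ax Bx.
exists C => // k; apply: Ck_scale; first by have [] := Cx.
- exact: Ck_sub (sf k).
- exact: Ck_sub (sg k).
Qed.

Lemma smooth_at_sum W m (f : 'I_m -> V -> W) :
  (forall j, smooth_at (f j) x) -> smooth_at (fun y => \sum_j f j y) x.
Proof.
elim: m f => [|m IH] f hf.
  by apply: smooth_at_ext (smooth_at_cst 0); near=> y; rewrite big_ord0.
apply: smooth_at_ext (smooth_atD
  (IH (fun j => f (widen_ord (leqnSn m) j)) (fun=> hf _)) (hf ord_max)).
by near=> y; rewrite big_ord_recr.
Unshelve. all: by end_near. Qed.

Lemma smooth_at_linear W Z (L : {linear W -> Z}) (f : V -> W) :
  continuous L -> smooth_at f x -> smooth_at (fun y => L (f y)) x.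
Proof.
move=> cL [A [oA Ax] sf]; exists A => // k; exact: Ck_linear.
Qed.

Lemma smooth_at_comp W Z (f : W -> Z) (g : V -> W) : has_coordinates W ->
  smooth_at f (g x) -> smooth_at g x -> smooth_at (fun y => f (g y)) x.
Proof.
move=> hW [B Bx sf] sg; have cg := smooth_at_continuous sg.
move: sg => [A Ax sg].
have : \forall y \near x, A y /\ B (g y).
  near=> y; split; near: y; first exact: open_nbhs_nbhs.
  exact/cg/open_nbhs_nbhs.
rewrite -nbhs_nearE nbhsE /= => -[C [oC Cx] CAB]; exists C => // k.
apply: (@Ck_comp _ _ _ _ _ B) => //; first by move=> y /CAB[].
by apply: Ck_sub (sg k) => y /CAB[].
Unshelve. all: by end_near. Qed.

Lemma smooth_at_derive_dir W (f : V -> W) v :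
  smooth_at f x -> smooth_at (fun y => 'D_v f y) x.
Proof. by case=> U Ux sf; exists U => // k; have [_] := sf k.+1; exact. Qed.

End SmoothAt.

(** Both the base point and the direction vary: this is the shape of a vector field rewritten in
    another chart. *)
Lemma smooth_at_derive V W Z (x : V) (f : W -> Z) (g h : V -> W) :
  has_coordinates W -> smooth_at f (g x) -> smooth_at g x -> smooth_at h x ->
  smooth_at (fun y => 'D_(h y) f (g y)) x.
Proof.
move=> hW sf sg sh; have [m [e [l [lc le]]]] := hW.
have : smooth_at (fun y => \sum_j l j (h y) *: 'D_(e j) f (g y)) x.
  apply: smooth_at_sum => j; apply: smooth_atZ; first exact: smooth_at_linear.
  apply: (smooth_at_comp (f := 'D_(e j) f)) => //.
  exact: smooth_at_derive_dir.
apply: smooth_at_ext.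
have : \forall y \near x, smooth_at f (g y).
  by apply: (smooth_at_continuous sg); exact: smooth_at_near.
apply: filterS => y /smooth_at_differentiable df.
by rewrite -derive_sum_dir -?le.
Qed.

End Calculus.

(** * Bump functions *)

Section Bump.
Variable R : realType.

Lemma derive_real (W : normedModType R) (f : R -> W) (t v : R) :
  differentiable f t -> 'D_v f t = v *: 'D_1 f t.
Proof.
move=> df; rewrite !deriveE//.
by rewrite -[in LHS](mulr1 v) -[v * 1]/(v *: (1 : R)) linearZ.
Qed.

(* Up to linear combinations, this family is closed under differentiation, and
   its members are O(t) at 0: hence all of them are smooth. *)
Definition flat_exp (k : nat) (t : R) : R :=
  if 0 < t then t^-1 ^+ k * expR (- t^-1) else 0.

Lemma flat_exp_gt0 k t : 0 < t -> 0 < flat_exp k t.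
Proof.
by move=> t0; rewrite /flat_exp t0 mulr_gt0// ?expR_gt0// exprn_gt0// invr_gt0.
Qed.

Lemma flat_exp_eq0 k t : t <= 0 -> flat_exp k t = 0.
Proof. by rewrite /flat_exp ltNge => ->. Qed.

Lemma flat_exp_ge0 k t : 0 <= flat_exp k t.
Proof.
by case: (ltP 0 t) => t0; [exact/ltW/flat_exp_gt0|rewrite flat_exp_eq0].
Qed.

(** For positive [t], put u = 1/t: the exponential series gives exp u >= u^(k+1)/(k+1)!, so u^k
    exp(-u) <= (k+1)!/u. *)
Lemma flat_exp_le k t : flat_exp k t <= k.+1`!%:R * `|t|.
Proof.
have [t0|t0] := ltP 0 t; last by rewrite flat_exp_eq0// mulr_ge0.
rewrite /flat_exp t0 gtr0_norm//.
have u0 : 0 < t^-1 by rewrite invr_gt0.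
have := expR_ge1Dxn k (ltW u0).
move=> /(le_trans _) H.
have {}H : t^-1 ^+ k.+1 / k.+1`!%:R <= expR t^-1 by apply: H; rewrite lerDr.
rewrite expRN ler_pdivrMr ?expR_gt0//.
apply: (@le_trans _ _ (k.+1`!%:R * t * (t^-1 ^+ k.+1 / k.+1`!%:R))); last first.
  by rewrite ler_wpM2l// mulr_ge0// ltW.
rewrite le_eqVlt; apply/orP; left; apply/eqP; rewrite exprS.
have f0 : (k.+1`!%:R : R) != 0 by rewrite pnatr_eq0 -lt0n fact_gt0.
have tn0 : t != 0 by rewrite gt_eqF.
by field; rewrite tn0 f0.
Qed.

Lemma is_derive_flat_exp k (t : R) :
  is_derive t (1 : R) (flat_exp k) (flat_exp k.+2 t - k%:R * flat_exp k.+1 t).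
Proof.
have [t0|t0|<-] := ltgtP 0 t.
- have tn0 : t != 0 by rewrite gt_eqF.
  have di : is_derive t 1 (fun y : R => y^-1) (- t ^- 2 *: 1).
    exact: (is_deriveV (f := id)).
  have de (u : R) : is_derive u (1 : R) (fun u : R => u ^+ k * expR (- u))
     (u ^+ k * - expR (- u) + expR (- u) * (k%:R * u ^+ k.-1)).
    have d1 : is_derive u 1 (fun u : R => expR (- u)) (- expR (- u)).
      have := @is_derive1_comp R expR -%R u _ _ (is_derive_expR _) (is_deriveNid u 1).
      by rewrite mulrN1.
    have d2 : is_derive u 1 (fun u : R => u ^+ k) (k%:R * u ^+ k.-1).
      apply: DeriveDef; first exact: exprn_derivable.
      by rewrite exp_derive scaler1.
    exact: is_deriveM.
  have H := is_derive1_comp (de t^-1) di.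
  have nE : \forall y \near t,
      ((fun u => u ^+ k * expR (- u)) \o (fun y => y^-1)) y = flat_exp k y.
    have : \forall y \near t, 0 < y by exact: lt_nbhsr.
    by apply: filterS => y y0; rewrite /flat_exp y0.
  apply: (is_derive_eq (near_eq_is_derive nE H)).
  rewrite /flat_exp t0 /GRing.scale /= !exprS.
  (* The case 0 is separate because the power rule produced the truncated exponent [k.-1]. *)
  case: k {de H nE} => [|k] /=.
    by rewrite !mul0r; field.
  by rewrite !exprS; field.
- have : is_derive t 1 (cst 0 : R -> R) 0 by exact: is_derive_cst.
  rewrite !flat_exp_eq0 1?ltW// mulr0 subr0; apply: near_eq_is_derive.
  have : \forall y \near t, y < 0 by exact: lt_nbhsl.
  by apply: filterS => y y0; rewrite flat_exp_eq0// ltW.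
- rewrite !flat_exp_eq0// mulr0 subr0.
  suff cv : (fun h : R => h^-1 *: ((flat_exp k \o shift 0) (h *: 1) - flat_exp k 0))
      @ 0^' --> (0 : R).
    by apply: DeriveDef; [apply/cvg_ex; exists 0|exact: (cvg_lim _ cv)].
  (* The difference quotient at 0 is itself the next member of the family, which tends to 0 by
     [flat_exp_le]. *)
  have E : (fun h : R => h^-1 *: ((flat_exp k \o shift 0) (h *: 1) - flat_exp k 0))
      = flat_exp k.+1.
    apply/funext => h; rewrite /= addr0 /GRing.scale /= mulr1.
    rewrite (@flat_exp_eq0 k 0)// subr0 /flat_exp.
    by case: ifP => _; rewrite ?mulr0// mulrA -exprS.
  rewrite E; apply/cvgrPdist_le => e e0.
  have C0 : 0 < (k.+2`!%:R : R) by rewrite ltr0n fact_gt0.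
  near=> h; rewrite sub0r normrN ger0_norm ?flat_exp_ge0//.
  apply: (le_trans (flat_exp_le _ _)).
  rewrite mulrC -ler_pdivlMr//.
  by near: h; apply: dnbhs0_le; rewrite divr_gt0.
Unshelve. all: by end_near. Qed.

Lemma Ck_flat_exp m k : Ck_on m setT (flat_exp k).
Proof.
have df k' t : differentiable (flat_exp k') t.
  by apply/derivable1_diffP; have [] := is_derive_flat_exp k' t.
elim: m k => [|m IH] k; first by move=> t _; exact: differentiable_continuous.
split=> [t _|v]; first exact: df.
have : Ck_on m setT (fun t => v *: (flat_exp k.+2 t + (- k%:R) *: flat_exp k.+1 t)).
  apply: Ck_scale; [exact: openT|exact: Ck_cst|].
  apply: CkD; [exact: openT|exact: IH|].
  by apply: Ck_scale; [exact: openT|exact: Ck_cst|exact: IH].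
apply: Ck_ext => t _; near=> s; rewrite derive_real//.
by have [_ ->] := is_derive_flat_exp k s; rewrite -mulNr.
Unshelve. all: by end_near. Qed.

(** The derivative of the inverse is minus its square, a product of functions already of class C^m
    by induction. *)
Lemma smooth_at_inv (t : R) : t != 0 -> smooth_at (fun s : R => s^-1) t.
Proof.
have oU : open [set s : R | s != 0].
  rewrite (_ : [set s : R | s != 0] = ~` [set 0]).
    exact/closed_openC/closed_eq.
  by apply/seteqP; split=> s /= => [/eqP//|] H; apply/eqP.
move=> t0; exists [set s : R | s != 0]; first by split.
move=> m; elim: m => [|m IH].
  by move=> s /= s0; exact: inv_continuous.
split=> [s /= s0|v]; first exact: differentiable_Rinv.
have : Ck_on m [set s : R | s != 0] (fun s => (- v) *: (s^-1 *: s^-1)).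
  by apply: Ck_scale => //; [exact: Ck_cst|exact: Ck_scale].
apply: Ck_ext => s s0; have := open_nbhs_nbhs (conj oU s0).
apply: filterS => r r0; rewrite derive_real; last exact: differentiable_Rinv.
have [_ ->] := is_deriveV (f := id) r0 (is_derive_id r 1).
by rewrite /GRing.scale /= mulr1 mulrN mulNr -invfM -expr2.
Qed.

(** A smooth cutoff falling from 1 to 0 between 1/2 and 1. The two terms of the denominator vanish
    on the disjoint half-lines t >= 1 and t <= 1/2, so their sum is positive everywhere. *)
Definition step (t : R) : R :=
  flat_exp 0 (1 - t) * (flat_exp 0 (1 - t) + flat_exp 0 (t - 2^-1))^-1.

Lemma step1 t : t <= 2^-1 -> step t = 1.
Proof.
move=> t2; rewrite /step (@flat_exp_eq0 _ (t - _)) ?subr_le0// addr0 divff//.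
by rewrite gt_eqF// flat_exp_gt0//; lra.
Qed.

Lemma step0 t : 1 <= t -> step t = 0.
Proof. by move=> t1; rewrite /step flat_exp_eq0 ?mul0r// subr_le0. Qed.

Lemma smooth_at_step (t : R) : smooth_at step t.
Proof.
have sf (s : R) : smooth_at (flat_exp 0) s.
  by exists setT; [split=> //; exact: openT|move=> m; exact: Ck_flat_exp].
have s1 : smooth_at (fun t : R => flat_exp 0 (1 - t)) t.
  apply: (smooth_at_comp (f := flat_exp 0)) => //; first exact: has_coordinates_real.
  have : smooth_at (fun y : R => 1 + (-1) *: y) t.
    apply: smooth_atD; first exact: smooth_at_cst.
    by apply: smooth_atZ; [exact: smooth_at_cst|exact: smooth_at_id].
  by apply: smooth_at_ext; near=> y; rewrite scaleN1r.
have s2 : smooth_at (fun t : R => flat_exp 0 (t - 2^-1)) t.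
  apply: (smooth_at_comp (f := flat_exp 0)) => //; first exact: has_coordinates_real.
  by apply: smooth_atD; [exact: smooth_at_id|exact: smooth_at_cst].
apply: smooth_atZ => //.
apply: (smooth_at_comp (f := fun s : R => s^-1)); first exact: has_coordinates_real.
  apply: smooth_at_inv; rewrite gt_eqF//.
  have [t1|t1] := ltP t 1.
    by rewrite ltr_pwDl ?flat_exp_ge0// flat_exp_gt0// subr_gt0.
  by rewrite ltr_wpDl ?flat_exp_ge0// flat_exp_gt0//; lra.
exact: smooth_atD.
Unshelve. all: by end_near. Qed.

Lemma norm_rV_gt n (x : 'rV[R]_n) (r : R) :
  0 <= r -> r < `|x| -> exists j, r < `|x 0 j|.
Proof.
move=> r0 rx; apply: contrapT => /forallNP H.
move: rx; rewrite ltNge => /negP; apply.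
rewrite /Num.Def.normr/= mx_normrE (bigmax_le _ r0)//= => -[i j] _ /=.
by rewrite (ord1 i) leNgt; apply/negP; exact: H.
Qed.

Lemma smooth_at_coord n (x : 'rV[R]_n) (j : 'I_n) :
  smooth_at (fun y : 'rV[R]_n => y 0 j : R) x.
Proof.
apply: (smooth_at_linear (L := rV_coord j)); last exact: smooth_at_id.
exact: coord_continuous.
Qed.

(** The norm of ['rV[R]_n] is the sup norm, which is not smooth; [phi] is therefore built from the
    Euclidean square [q]. The set [K] is a closed sup-norm ball: outside it one coordinate of
    [x - a] already exceeds [r], so [q x] exceeds the square of [r] and [step] vanishes. *)
Lemma exists_bump n (a : 'rV[R]_n) (A : set 'rV[R]_n) : nbhs a A ->
  exists (phi : 'rV[R]_n -> R) (K : set 'rV[R]_n),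
    [/\ compact K, K `<=` A, forall x, smooth_at phi x,
        \forall x \near a, phi x = 1 & forall x, ~ K x -> phi x = 0].
Proof.
move=> /nbhs_ballP[e /= e0 eA].
(* Half the radius, so that the closed ball of radius [r] lies in the open ball of radius [e]. *)
pose r := e / 2; have r0 : 0 < r by rewrite divr_gt0.
pose q (x : 'rV[R]_n) : R := \sum_j (x 0 j - a 0 j) *: (x 0 j - a 0 j).
have sq x : smooth_at q x.
  apply: smooth_at_sum => j.
  have : smooth_at (fun y : 'rV[R]_n => y 0 j - a 0 j : R) x.
    by apply: smooth_atD; [exact: smooth_at_coord|exact: smooth_at_cst].
  by move=> s; exact: smooth_atZ.
have sqr x : smooth_at (fun y => (r ^- 2) *: q y) x.
  by apply: smooth_atZ; [exact: smooth_at_cst|].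
exists (fun x => step (r ^- 2 *: q x)), (closed_ball_ (fun x => `|x|) a r); split.
- apply: bounded_closed_compact; last exact: closed_closed_ball_.
  exists (`|a| + r); split; first exact: num_real.
  move=> M aM x /= xr; rewrite (le_trans _ (ltW aM))//.
  by rewrite -[x](subrK a) addrC (le_trans (ler_normD _ _))// lerD2l distrC.
- move=> x /= xr; apply: eA; rewrite -ball_normE /ball_/=.
  by rewrite (le_lt_trans xr)// ltr_pdivrMr// ltr_pMr// ltr1n.
- move=> x; apply: (smooth_at_comp (f := step)) => //.
    exact: has_coordinates_real.
  exact: smooth_at_step.
- have qa : r ^- 2 *: q a = 0.
    by rewrite /q big1 ?scaler0// => j _; rewrite subrr scaler0.
  have c := smooth_at_continuous (sqr a).
  have : \forall x \near a, r ^- 2 *: q x < 2^-1.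
    apply: (c [set t | t < 2^-1]); rewrite qa; apply: lt_nbhsl.
    by rewrite invr_gt0.
  by apply: filterS => x /ltW/step1.
- move=> x /= /negP; rewrite -ltNge distrC => xr.
  have [j rj] := norm_rV_gt (ltW r0) xr.
  apply: step0; rewrite /GRing.scale /= mulrC ler_pdivlMr ?exprn_gt0// mul1r.
  rewrite /q (bigD1 j)//=; apply: ler_wpDr.
    by apply: sumr_ge0 => i _; rewrite /GRing.scale /= -expr2 sqr_ge0.
  rewrite /GRing.scale /= -expr2 -[leRHS]real_normK ?num_real//.
  by rewrite !mxE in rj; rewrite lerXn2r ?nnegrE// ltW.
Qed.

End Bump.

(** * Vector fields on manifolds *)

Section LinearRV.
Variables (R : realType) (m : nat) (W : normedModType R).
Variable L : {linear 'rV[R]_m -> W}.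

Lemma smooth_at_linear_rV (x : 'rV[R]_m) : smooth_at L x.
Proof.
have : smooth_at (fun y : 'rV[R]_m => \sum_j y 0 j *: L (delta_mx 0 j)) x.
  apply: smooth_at_sum => j; apply: smooth_atZ; first exact: smooth_at_coord.
  exact: smooth_at_cst.
apply: smooth_at_ext; near=> y; rewrite [in RHS](row_sum_delta y) linear_sum.
by apply: eq_bigr => j _; rewrite linearZ.
Unshelve. all: by end_near. Qed.

Lemma linear_rV_continuous : continuous L.
Proof. by move=> x; exact/smooth_at_continuous/smooth_at_linear_rV. Qed.

Lemma derive_linear_rV x v : 'D_v L x = L v.
Proof.
rewrite deriveE; last exact/smooth_at_differentiable/smooth_at_linear_rV.
by rewrite diff_lin//; exact: linear_rV_continuous.
Qed.

End LinearRV.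

(** * Neighbourhoods seen through a chart *)

Section Charts.
Variables (R : realType) (T : topologicalType) (n : nat) (c : chart R T n).

Lemma near_dom p : dom c p -> \forall q \near p, dom c q.
Proof. by move=> cp; exact: open_nbhs_nbhs (conj (dom_open c) cp). Qed.

Lemma near_codom p : dom c p -> \forall x \near to_coord c p, (to_coord c @` dom c) x.
Proof.
by move=> cp; apply: open_nbhs_nbhs; split; [exact: codom_open|exists p].
Qed.

Lemma near_of_coord p (P : T -> Prop) : dom c p ->
  (\forall q \near p, P q) -> \forall x \near to_coord c p, P (of_coord c x).
Proof.
move=> cp Pp; have := @of_coord_continuous _ _ _ c.
rewrite continuous_open_subspace; last exact: codom_open.
have /[swap] /[apply] : to_coord c p \in to_coord c @` dom c by rewrite inE; exists p.
by apply; rewrite /= to_coordK.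
Qed.

Lemma near_to_coord p (P : 'rV[R]_n -> Prop) : dom c p ->
  (\forall x \near to_coord c p, P x) -> \forall q \near p, P (to_coord c q).
Proof.
move=> cp Pp; have := @to_coord_continuous _ _ _ c.
rewrite continuous_open_subspace; last exact: dom_open.
have /[swap] /[apply] : p \in dom c by rewrite inE.
exact.
Qed.

Lemma of_coordK x : (to_coord c @` dom c) x -> to_coord c (of_coord c x) = x.
Proof. by case=> p cp <-; rewrite to_coordK. Qed.

Lemma of_coord_dom x : (to_coord c @` dom c) x -> dom c (of_coord c x).
Proof. by case=> p cp <-; rewrite to_coordK. Qed.

Lemma to_coord_open (A : set T) : open A -> A `<=` dom c -> open (to_coord c @` A).
Proof.
move=> oA Ac; rewrite openE => _ [p Ap <-]; have cp := Ac _ Ap.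
have Anear : \forall x \near to_coord c p, A (of_coord c x).
  by apply: near_of_coord => //; exact: open_nbhs_nbhs.
rewrite /interior; apply: filterS2 (near_codom cp) Anear => x cx Ax.
by exists (of_coord c x) => //; rewrite of_coordK.
Qed.

End Charts.

(** * Tangent vectors and smooth vector fields in charts of the maximal atlas *)

Section ManifoldCalculus.
Variables (R : realType) (n : nat) (M : manifold R n).
Implicit Types (c d e : chart R M n) (q : M) (X Y : M -> 'rV[R]_n).

Lemma atlas_smooth_chart c : atlas c -> smooth_chart c.
Proof. by move=> ac d ad; split; exact: atlas_smooth. Qed.

Lemma chart_at_smooth q : smooth_chart (chart_at q).
Proof. exact/atlas_smooth_chart/chart_at_atlas. Qed.

Hint Resolve chart_at_smooth chart_at_dom : core.

Definition transition c d := to_coord d \o of_coord c.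

Lemma transitionE c d q : dom c q -> transition c d (to_coord c q) = to_coord d q.
Proof. by move=> cq; rewrite /transition /= to_coordK. Qed.

Lemma transition_smooth_at c d q : transition_smooth c d -> dom c q -> dom d q ->
  smooth_at (transition c d) (to_coord c q).
Proof.
move=> s cq dq; move: s; rewrite /transition_smooth smooth_onP; last first.
  apply: to_coord_open; last exact: subIsetl.
  by apply: openI; exact: dom_open.
by apply; exists q.
Qed.

(** Charts of the maximal atlas are only compared with those of [atlas], so the transition is
    factored, near [q], through [chart_at q]. *)
Lemma smooth_at_transition c d q : smooth_chart c -> smooth_chart d ->
  dom c q -> dom d q -> smooth_at (transition c d) (to_coord c q).
Proof.
move=> sc sd cq dq; pose e := chart_at q.
have [sce _] := sc e (chart_at_atlas q).
have [_ sed] := sd e (chart_at_atlas q).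
have eq : dom e q by exact: chart_at_dom.
have h1 := transition_smooth_at sce cq eq.
have h2 := transition_smooth_at sed eq dq.
rewrite -(transitionE e cq) in h2.
apply: smooth_at_ext (smooth_at_comp (@has_coordinates_rV _ _) h2 h1).
have := near_of_coord cq (near_dom eq).
by apply: filterS => x ex; rewrite /transition /= to_coordK.
Qed.

Definition tangent_change c d q (v : 'rV[R]_n) : 'rV[R]_n :=
  'D_v (transition c d) (to_coord c q).

Lemma componentsE c q v : components c q v = tangent_change (chart_at q) c q v.
Proof. by []. Qed.

(** The cocycle rule, which is the chain rule for composed transitions. *)
Lemma tangent_changeK c d e q v :
  smooth_chart c -> smooth_chart d -> smooth_chart e ->
  dom c q -> dom d q -> dom e q ->
  tangent_change d e q (tangent_change c d q v) = tangent_change c e q v.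
Proof.
move=> sc sd se cq dq eq.
have h1 := smooth_at_differentiable (smooth_at_transition sc sd cq dq).
have h2 := smooth_at_differentiable (smooth_at_transition sd se dq eq).
rewrite /tangent_change; rewrite -(transitionE d cq) in h2 *.
rewrite -derive_comp//; apply: near_eq_derive.
have := near_of_coord cq (near_dom dq).
by apply: filterS => x dx; rewrite /transition /= to_coordK.
Qed.

Lemma tangent_change_id c q v : dom c q -> tangent_change c c q v = v.
Proof.
move=> cq; rewrite -[RHS](derive_id (to_coord c q) v).
apply: near_eq_derive.
by apply: filterS (near_codom cq) => x; exact: of_coordK.
Qed.

Lemma tangent_changeP c d q a u v : smooth_chart c -> smooth_chart d ->
  dom c q -> dom d q ->
  tangent_change c d q (a *: u + v) =
  a *: tangent_change c d q u + tangent_change c d q v.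
Proof.
move=> sc sd cq dq.
have h := smooth_at_differentiable (smooth_at_transition sc sd cq dq).
by rewrite /tangent_change !deriveE// linearP.
Qed.

Lemma componentsP c q a u v : smooth_chart c -> dom c q ->
  components c q (a *: u + v) = a *: components c q u + components c q v.
Proof. by move=> sc cq; exact: tangent_changeP. Qed.

Lemma components0 c q : components c q 0 = 0.
Proof. exact: derive0. Qed.

Lemma componentsZ c q a u : smooth_chart c -> dom c q ->
  components c q (a *: u) = a *: components c q u.
Proof.
by move=> sc cq; rewrite -[a *: u]addr0 componentsP// components0 addr0.
Qed.

(** The inverse of [components c q]: from components in [c] back to the representation in
    [chart_at q]. *)
Definition tangent_of c q (w : 'rV[R]_n) : 'rV[R]_n :=
  tangent_change c (chart_at q) q w.

Lemma tangent_ofK c q w : smooth_chart c -> dom c q ->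
  components c q (tangent_of c q w) = w.
Proof.
by move=> sc cq; rewrite componentsE tangent_changeK// tangent_change_id.
Qed.

Lemma componentsK c q v : smooth_chart c -> dom c q ->
  tangent_of c q (components c q v) = v.
Proof.
by move=> sc cq; rewrite /tangent_of tangent_changeK// tangent_change_id.
Qed.

(** The chart [c] parametrizes the points and [d] gives the components; they are kept apart because
    [smooth_along] quantifies over such pairs. *)
Definition local_vfield c d X (x : 'rV[R]_n) : 'rV[R]_n :=
  components d (of_coord c x) (X (of_coord c x)).

(** Near [q] the second expression is the derivative of the transition from [d1] to [d2], at a
    moving point and in the direction given by the first expression; [smooth_at_derive] applies. *)
Lemma smooth_at_local_vfield c1 d1 c2 d2 X q :
  smooth_chart c1 -> smooth_chart d1 -> smooth_chart c2 -> smooth_chart d2 ->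
  dom c1 q -> dom d1 q -> dom c2 q -> dom d2 q ->
  smooth_at (local_vfield c1 d1 X) (to_coord c1 q) ->
  smooth_at (local_vfield c2 d2 X) (to_coord c2 q).
Proof.
move=> sc1 sd1 sc2 sd2 c1q d1q c2q d2q sX.
have h12 := smooth_at_transition sd1 sd2 d1q d2q.
have h21 := smooth_at_transition sc2 sd1 c2q d1q.
have h11 := smooth_at_transition sc2 sc1 c2q c1q.
rewrite -(transitionE d1 c2q) in h12; rewrite -(transitionE c1 c2q) in sX.
have sX' := smooth_at_comp (@has_coordinates_rV _ _) sX h11.
apply: smooth_at_ext (smooth_at_derive (@has_coordinates_rV _ _) h12 h21 sX').
have n1 := near_of_coord c2q (near_dom c1q).
have n2 := near_of_coord c2q (near_dom d1q).
have n3 := near_of_coord c2q (near_dom d2q).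
apply: filterS3 n1 n2 n3 => x c1x d1x d2x.
by rewrite /local_vfield /transition /= to_coordK// !componentsE
  -(@tangent_changeK (chart_at (of_coord c2 x)) d1 d2).
Qed.

Lemma smooth_vfieldP X : smooth_vfield X <->
  forall q c d, smooth_chart c -> smooth_chart d -> dom c q -> dom d q ->
    smooth_at (local_vfield c d X) (to_coord c q).
Proof.
have op c d : open (to_coord c @` (dom c `&` (fun p : M => p) @^-1` dom d)).
  apply: to_coord_open; last exact: subIsetl.
  by apply: openI; exact: dom_open.
split=> [sX q c d sc sd cq dq|sX c d ac ad].
  have e : dom (chart_at q) q by [].
  apply: (@smooth_at_local_vfield (chart_at q) (chart_at q)) => //.
  have := sX _ _ (chart_at_atlas q) (chart_at_atlas q).
  rewrite smooth_onP//; apply; by exists q.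
by apply/smooth_onP => // _ [q [cq dq] <-]; apply: sX => //; exact: atlas_smooth_chart.
Qed.

Lemma smooth_vfield_at X :
  (forall q, exists c d, [/\ smooth_chart c, smooth_chart d, dom c q, dom d q &
    smooth_at (local_vfield c d X) (to_coord c q)]) -> smooth_vfield X.
Proof.
move=> sX; apply/smooth_vfieldP => q c d sc sd cq dq.
have [c1 [d1 [sc1 sd1 c1q d1q]]] := sX q.
exact: smooth_at_local_vfield.
Qed.

Lemma smooth_vfieldPlus a X Y : smooth_vfield X -> smooth_vfield Y ->
  smooth_vfield (fun q => a *: X q + Y q).
Proof.
move=> /smooth_vfieldP sX /smooth_vfieldP sY; apply: smooth_vfield_at => q.
exists (chart_at q), (chart_at q); split=> //.
have sXq := sX q _ _ (chart_at_smooth q) (chart_at_smooth q)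
  (chart_at_dom q) (chart_at_dom q).
have sYq := sY q _ _ (chart_at_smooth q) (chart_at_smooth q)
  (chart_at_dom q) (chart_at_dom q).
apply: smooth_at_ext (smooth_atD (smooth_atZ (smooth_at_cst _ a) sXq) sYq).
have := near_of_coord (chart_at_dom q) (near_dom (chart_at_dom q)).
by apply: filterS => x ex; rewrite /local_vfield componentsP.
Qed.

(** The local field with components [h] is multiplied by a bump function and extended by 0, which
    gives a global field with the same germ at [p]. *)
Lemma exists_vfield c p (h : 'rV[R]_n -> 'rV[R]_n) : smooth_chart c -> dom c p ->
  (forall x, (to_coord c @` dom c) x -> smooth_at h x) ->
  exists2 X, smooth_vfield X &
    \forall q \near p, X q = tangent_of c q (h (to_coord c q)).
Proof.
move=> sc cp sh; have [phi [K [cK Kc sphi phi1 phi0]]] := exists_bump (near_codom cp).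
pose X q := if `[< dom c q >] then phi (to_coord c q) *: tangent_of c q (h (to_coord c q))
            else 0.
exists X; last first.
  apply: filterS2 (near_dom cp) (near_to_coord cp phi1) => q cq q1.
  by rewrite /X asboolT// q1 scale1r.
apply: smooth_vfield_at => q; have [cq|ncq] := pselect (dom c q).
  exists c, c; split=> //.
  have cqx : (to_coord c @` dom c) (to_coord c q) by exists q.
  apply: smooth_at_ext (smooth_atZ (sphi _) (sh _ cqx)).
  apply: filterS (near_codom cq) => x cx; have dx := of_coord_dom cx.
  by rewrite /local_vfield /X asboolT// componentsZ// tangent_ofK// of_coordK.
exists (chart_at q), (chart_at q); split=> //.
(* At points outside [dom c], smoothness rests on the Hausdorff property: the image of the compact
   [K] is closed, so [X] vanishes on a whole neighbourhood of [q]. *)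
have cl : closed (of_coord c @` K).
  apply: (compact_closed (@manifold_hausdorff _ _ M)).
  apply: continuous_compact => //.
  apply: continuous_subspaceW Kc _; exact: of_coord_continuous.
have nq : \forall r \near q, ~ (of_coord c @` K) r.
  apply: open_nbhs_nbhs; split; first exact: closed_openC.
  by move=> [x /Kc cx xq]; apply: ncq; rewrite -xq; exact: of_coord_dom.
apply: smooth_at_ext (smooth_at_cst _ 0).
apply: filterS (near_of_coord (chart_at_dom q) nq) => x nx.
rewrite /local_vfield /X; case: asboolP => [cx|_]; last by rewrite components0.
rewrite phi0 ?scale0r ?components0// => Kx; apply: nx.
by exists (to_coord c (of_coord (chart_at q) x)) => //; rewrite to_coordK.
Qed.

End ManifoldCalculus.

(** * Totally geodesic hypersurfaces *)

Section Inner.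
Variables (R : realType) (n : nat) (T : manifold R n) (g : T -> 'M[R]_n) (q : T).
Implicit Types u v w : 'rV[R]_n.

Lemma innerPr a u v w : inner g q w (a *: u + v) = a * inner g q w u + inner g q w v.
Proof. by rewrite /inner linearP /= mulmxDr -scalemxAr !mxE. Qed.

Lemma inner0r w : inner g q w 0 = 0.
Proof. by rewrite /inner trmx0 mulmx0 mxE. Qed.

Lemma innerDr u v w : inner g q w (u + v) = inner g q w u + inner g q w v.
Proof. by have := innerPr 1 u v w; rewrite scale1r mul1r. Qed.

Lemma innerZr a u w : inner g q w (a *: u) = a * inner g q w u.
Proof. by have := innerPr a u 0 w; rewrite inner0r !addr0. Qed.

Lemma innerNr u w : inner g q w (- u) = - inner g q w u.
Proof. by rewrite -scaleN1r innerZr mulN1r. Qed.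

Lemma innerBr u v w : inner g q w (u - v) = inner g q w u - inner g q w v.
Proof. by rewrite innerDr innerNr. Qed.

End Inner.

(** The two conditions form a matrix with [n.+1] rows and 2 columns; as [n.+1] exceeds 2, its left
    kernel is nonzero. *)
Lemma exists_orthogonal_pair (R : realType) n (hn : (1 < n)%N) (T : manifold R n.+1)
    (g : T -> 'M[R]_n.+1) q (a b : 'rV[R]_n.+1) :
  exists2 x, x != 0 & inner g q x a = 0 /\ inner g q x b = 0.
Proof.
pose A : 'M[R]_(n.+1, 1 + 1) := row_mx (g q *m a^T) (g q *m b^T).
have : kermx A != 0.
  rewrite kermx_eq0 /row_free neq_ltn; apply/orP; left.
  by rewrite (leq_ltn_trans (rank_leq_col A)).
move=> /rowV0Pn[x /sub_kermxP xA x0]; exists x => //.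
rewrite /inner -!mulmxA.
have : row_mx (x *m (g q *m a^T)) (x *m (g q *m b^T)) = 0.
  by rewrite -mul_mx_row.
by rewrite -[X in _ = X -> _]row_mx0 => /eq_row_mx[-> ->]; rewrite !mxE.
Qed.

(** * The hyperplane of vanishing first coordinate, local model of an immersed hypersurface *)

Section Slice.
Variables (R : realType) (n : nat).

Definition slice (x : 'rV[R]_n) : 'rV[R]_n.+1 := row_mx (0 : 'rV[R]_1) x.

Definition last_coords (v : 'rV[R]_n.+1) : 'rV[R]_n := rsubmx (v : 'rV[R]_(1 + n)).

Definition first_coord (v : 'rV[R]_n.+1) : 'rV[R]_1 := lsubmx (v : 'rV[R]_(1 + n)).

Lemma slice_is_linear : linear slice.
Proof.
(* Stated at width [1 + n], convertible to [n.+1], where the block matrix lemmas apply. *)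
have lin : linear (row_mx 0 : 'rV[R]_n -> 'rV[R]_(1 + n)).
  by move=> a u v; rewrite scale_row_mx add_row_mx scaler0 addr0.
exact: lin.
Qed.

HB.instance Definition _ := GRing.isLinear.Build R _ _ _ slice slice_is_linear.

Lemma last_coords_is_linear : linear last_coords.
Proof. by move=> a u v; exact: linearP. Qed.

HB.instance Definition _ :=
  GRing.isLinear.Build R _ _ _ last_coords last_coords_is_linear.

Lemma first_coord_is_linear : linear first_coord.
Proof. by move=> a u v; exact: linearP. Qed.

HB.instance Definition _ :=
  GRing.isLinear.Build R _ _ _ first_coord first_coord_is_linear.

Lemma first_coord_slice w : first_coord (slice w) = 0.
Proof. exact: row_mxKl. Qed.

Lemma slice_last_coords v : first_coord v = 0 -> slice (last_coords v) = v.
Proof.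
by move=> v0; rewrite /slice -[RHS](@hsubmxK _ 1 1 n) -/(first_coord v) v0.
Qed.

End Slice.
Arguments slice {R n}.
Arguments last_coords {R n}.
Arguments first_coord {R n}.

Section Hypersurface.
Variables (R : realType) (n : nat) (M : manifold R n) (Mt : manifold R n.+1).
Variables (gt : Mt -> 'M[R]_n.+1)
  (D : (Mt -> 'rV[R]_n.+1) -> (Mt -> 'rV[R]_n.+1) -> (Mt -> 'rV[R]_n.+1)).
Variables (i : M -> Mt) (N : M -> 'rV[R]_n.+1).

Section AdaptedCharts.
Variables (c : chart R M n) (d : chart R Mt n.+1).
Hypotheses (sc : smooth_chart c) (sd : smooth_chart d).
Hypothesis cd : i @` dom c `<=` dom d.
Hypothesis coordE : forall q, dom c q -> to_coord d (i q) = slice (to_coord c q).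

Lemma adapted_dom q : dom c q -> dom d (i q).
Proof. by move=> cq; apply: cd; exists q. Qed.

Lemma of_coord_slice q : dom c q -> of_coord d (slice (to_coord c q)) = i q.
Proof. by move=> cq; rewrite -coordE// to_coordK//; exact: adapted_dom. Qed.

(** Near [q] the coordinate expression of [i] factors as the transition into [c], then [slice], then
    the transition out of [d]; the chain rule does the rest. *)
Lemma tangent_map_adapted q v : dom c q ->
  tangent_map i q v = tangent_of d (i q) (slice (components c q v)).
Proof.
move=> cq; have eq := chart_at_dom q; have se := chart_at_smooth q.
have dq := adapted_dom cq.
have diq := chart_at_dom (i q); have sdi := chart_at_smooth (i q).
have h1 := smooth_at_differentiable (smooth_at_transition se sc eq cq).
have h2 := smooth_at_differentiable (smooth_at_transition sd sdi dq diq).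
have h3 := smooth_at_differentiable (smooth_at_linear_rV slice (to_coord c q)).
rewrite componentsE /tangent_of /tangent_change.
rewrite -(derive_linear_rV slice (to_coord c q)).
rewrite coordE// in h2 *.
rewrite -(transitionE c eq) in h2 h3 *.
rewrite -(derive_comp _ h1 h3) -(derive_comp (g := slice \o _) _ _ h2); last first.
  exact: differentiable_comp.
apply: near_eq_derive.
apply: filterS (near_of_coord eq (near_dom cq)) => x cx.
by rewrite /= /transition /= of_coord_slice.
Qed.

Lemma components_tangent_map q v : dom c q ->
  components d (i q) (tangent_map i q v) = slice (components c q v).
Proof.
by move=> cq; rewrite tangent_map_adapted// tangent_ofK//; exact: adapted_dom.
Qed.

(** In adapted charts tangency is one linear equation, the same at every point of [dom c]. *)
Lemma tangent_toP q v : dom c q ->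
  tangent_to i q v <-> first_coord (components d (i q) v) = 0.
Proof.
move=> cq; split=> [[w ->]|v0].
  by rewrite components_tangent_map// first_coord_slice.
exists (tangent_of c q (last_coords (components d (i q) v))).
rewrite tangent_map_adapted// tangent_ofK// slice_last_coords// componentsK//.
exact: adapted_dom.
Qed.

(** [totally_geodesic] speaks of fields on [M]; this recovers one from an ambient field tangent
    along [i], by reading it in [d] on the slice and dropping the zero coordinate. *)
Lemma tangent_extension p (E : Mt -> 'rV[R]_n.+1) : dom c p ->
  smooth_vfield E -> (\forall q \near p, tangent_to i q (E (i q))) ->
  exists2 W : M -> 'rV[R]_n, smooth_vfield W & extends_near i p W E.
Proof.
move=> cp /smooth_vfieldP sE tE.
pose h x := last_coords (local_vfield d d E (slice x)).
have sh x : (to_coord c @` dom c) x -> smooth_at h x.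
  move=> [q cq <-]; apply: (smooth_at_linear (L := last_coords)).
    exact: linear_rV_continuous.
  apply: (smooth_at_comp (f := local_vfield d d E)).
  - exact: has_coordinates_rV.
  - by rewrite -coordE//; apply: sE => //; exact: adapted_dom.
  - exact: smooth_at_linear_rV.
have [W sW WE] := exists_vfield sc cp sh; exists W => //.
apply: filterS3 (near_dom cp) tE WE => q cq tq ->.
rewrite tangent_map_adapted// tangent_ofK// /h /local_vfield of_coord_slice//.
rewrite slice_last_coords ?componentsK//; first exact: adapted_dom.
exact/tangent_toP.
Qed.

Lemma exists_tangent_vfield p v : dom c p -> tangent_to i p v ->
  exists X : Mt -> 'rV[R]_n.+1, [/\ smooth_vfield X, X (i p) = v &
    \forall q \near p, tangent_to i q (X (i q))].
Proof.
move=> cp /(tangent_toP _ cp) v0; have dp := adapted_dom cp.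
pose w := components d (i p) v.
have [X sX XE] := exists_vfield (h := fun=> w) sd dp (fun x _ => smooth_at_cst x w).
exists X; split=> //; first by rewrite (nbhs_singleton XE) componentsK.
have := near_of_coord dp XE; rewrite coordE// => XE'.
have cs := @linear_rV_continuous _ _ _ slice (to_coord c p).
have := near_to_coord cp (cs _ XE').
apply: filterS2 (near_dom cp) => q cq /=; rewrite of_coord_slice// => ->.
by apply/tangent_toP => //; rewrite tangent_ofK//; exact: adapted_dom.
Qed.

End AdaptedCharts.

Variable g : M -> 'M[R]_n.
Hypothesis hM : hypersurface gt i N g.

Lemma adapted_charts p : exists (c : chart R M n) (d : chart R Mt n.+1),
  [/\ smooth_chart c, smooth_chart d, dom c p, i @` dom c `<=` dom d &
      forall q, dom c q -> to_coord d (i q) = slice (to_coord c q)].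
Proof. exact: (hyp_immersed hM). Qed.

Lemma tangent_toPl p a u v : tangent_to i p u -> tangent_to i p v ->
  tangent_to i p (a *: u + v).
Proof.
have [c [d [sc sd cp cd coordE]]] := adapted_charts p.
move=> /(tangent_toP sc sd cd coordE _ cp) u0 /(tangent_toP sc sd cd coordE _ cp) v0.
apply/(tangent_toP sc sd cd coordE _ cp).
rewrite componentsP//; last exact: adapted_dom cp.
by rewrite linearP /= u0 v0 scaler0 addr0.
Qed.

Lemma inner_normal_tangent p v : tangent_to i p v -> inner gt (i p) (N p) v = 0.
Proof. by move=> [w ->]; exact: hyp_normal hM _ _. Qed.

Lemma tangent_normal_decomposition p v : exists s : R, tangent_to i p (v - s *: N p).
Proof.
have [c [d [sc sd cp cd coordE]]] := adapted_charts p.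
(* The first coordinate of the normal is nonzero: otherwise [N p] would be tangent, hence orthogonal
   to itself, against its unit length. Dividing by it gives the normal coefficient. *)
pose nu := first_coord (components d (i p) (N p)) 0 0.
have nu0 : nu != 0.
  apply/eqP => nu0; have /inner_normal_tangent : tangent_to i p (N p).
    apply/(tangent_toP sc sd cd coordE _ cp); apply/rowP => j.
    by rewrite (ord1 j) [LHS]nu0 mxE.
  by rewrite (hyp_unit hM) => /eqP; rewrite oner_eq0.
exists (first_coord (components d (i p) v) 0 0 / nu).
apply/(tangent_toP sc sd cd coordE _ cp); apply/rowP => j; rewrite (ord1 j).
have dp := adapted_dom cd cp.
rewrite addrC -scaleNr componentsP// linearP /= 3!mxE -/nu.
by rewrite mulNr divfK// addNr mxE.
Qed.

Lemma tangent_to_orthogonal p v : inner gt (i p) (N p) v = 0 -> tangent_to i p v.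
Proof.
move=> v0; have [s ts] := tangent_normal_decomposition p v.
have := inner_normal_tangent ts.
rewrite innerBr v0 innerZr (hyp_unit hM) mulr1 sub0r => /eqP.
by rewrite oppr_eq0 => /eqP s0; move: ts; rewrite s0 scale0r subr0.
Qed.

(** * Tangency of covariant derivatives and of the curvature *)

Hypothesis hgeodesic : totally_geodesic D i N.

(** The conclusion holds near [p] and not just at [p], so that it can be fed back for iterated
    derivatives. *)
Lemma tangent_connection (p : M) (X Y : Mt -> 'rV[R]_n.+1) :
  smooth_vfield X -> smooth_vfield Y ->
  (\forall q \near p, tangent_to i q (X (i q))) ->
  (\forall q \near p, tangent_to i q (Y (i q))) ->
  \forall q \near p, tangent_to i q (D X Y (i q)).
Proof.
have [c [d [sc sd cp cd coordE]]] := adapted_charts p => sX sY tX tY.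
have [X0 sX0 XE] := tangent_extension sc sd cd coordE cp sX tX.
have [Y0 sY0 YE] := tangent_extension sc sd cd coordE cp sY tY.
(* [second_form] at a nearby [q] asks for extensions valid in a neighbourhood of [q]. *)
have {}XE := nbhs_interior XE; have {}YE := nbhs_interior YE.
apply: filterS2 XE YE => q XE YE.
have [s ts] := tangent_normal_decomposition q (D X Y (i q)).
have s0 : s = 0.
  apply: (hgeodesic sX0 sY0 (p := q)).
  by exists X, Y.
by move: ts; rewrite s0 scale0r subr0.
Qed.

Lemma tangent_curvature (p : M) (X Y Z : Mt -> 'rV[R]_n.+1) :
  affine_connection D -> torsion_free D ->
  smooth_vfield X -> smooth_vfield Y -> smooth_vfield Z ->
  (\forall q \near p, tangent_to i q (X (i q))) ->
  (\forall q \near p, tangent_to i q (Y (i q))) ->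
  (\forall q \near p, tangent_to i q (Z (i q))) ->
  tangent_to i p (curvature D X Y Z (i p)).
Proof.
move=> hD tD sX sY sZ tX tY tZ; have sD := connection_smooth hD.
(* Vanishing torsion makes both the smoothness and the tangency of the bracket consequences of those
   of [D]. *)
have bE : lie_bracket X Y = (fun q => (-1) *: D Y X q + D X Y q).
  by apply/funext => q; rewrite -tD// scaleN1r addrC.
have sb : smooth_vfield (lie_bracket X Y).
  by rewrite bE; apply: smooth_vfieldPlus; exact: sD.
have tb : \forall q \near p, tangent_to i q (lie_bracket X Y (i q)).
  rewrite bE; apply: filterS2 (tangent_connection sY sX tY tX)
    (tangent_connection sX sY tX tY) => q t1 t2.
  exact: tangent_toPl.
have t1 := nbhs_singleton
  (tangent_connection sX (sD _ _ sY sZ) tX (tangent_connection sY sZ tY tZ)).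
have t2 := nbhs_singleton
  (tangent_connection sY (sD _ _ sX sZ) tY (tangent_connection sX sZ tX tZ)).
have t3 := nbhs_singleton (tangent_connection sb sZ tb tZ).
rewrite /curvature addrC -scaleN1r; apply: tangent_toPl => //.
by rewrite addrC -scaleN1r; exact: tangent_toPl.
Qed.

End Hypersurface.

(* [hn] says that Mt has dimension at least 3. On R^2 with F = diag(1, -1),
   metric 2(1 + v^2) du^2 + 2 du dv + 2(1 + u^2) dv^2, and the connection whose
   only nonzero Christoffel symbols are Gamma^u_uu = -4v, Gamma^v_vv = -4u, all
   the other hypotheses hold for the diagonal u = v and c = 1, but the curvature
   does not vanish. *)
Theorem theorem5p8 (R : realType) (n : nat) (hn : (1 < n)%N)
    (Mt : manifold R n.+1) (gt : Mt -> 'M[R]_n.+1)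
    (D : (Mt -> 'rV[R]_n.+1) -> (Mt -> 'rV[R]_n.+1) -> (Mt -> 'rV[R]_n.+1))
    (F Fs : Mt -> 'M[R]_n.+1)
    (hMt : product_like_statistical_manifold gt D F Fs)
    (c : R) (hcurv : product_space_form gt D F c)
    (M : manifold R n) (g : M -> 'M[R]_n) (i : M -> Mt) (N : M -> 'rV[R]_n.+1)
    (hM : hypersurface gt i N g)
    (htangential : tangential i N F Fs)
    (hgeodesic : totally_geodesic D i N) :
  flat D.
Proof.
suff c0 : c = 0.
  by move=> X Y Z sX sY sZ p; rewrite hcurv// c0 scale0r.
apply: contrapT => /eqP c0.
have [hg hD tD _] := pl_statistical hMt.
have [p _] := hyp_nonempty hM.
pose q := i p; pose G := inner gt q; pose eta := N p *m Fs q.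
have Gsym u v : G u v = G v u := Defs.metric_sym hg q u v.
have Gadj u v : G (u *m F q) v = G u (v *m Fs q) := pl_adj hMt q u v.
have FF u : u *m F q *m F q = u by rewrite -mulmxA (pl_square hMt) mulmx1.
have teta : tangent_to i p eta by have [] := htangential p.
have Geta u : G (N p) (u *m F q) = G u eta by rewrite Gsym Gadj.
have GG : G eta eta != 0.
  rewrite gt_eqF//; apply: (Defs.metric_pos hg); apply/eqP => eta0.
  (* Taking [u] to be FN, and F being an involution, gives <N, N> = <FN, eta>; so eta = 0 would
     force 1 = 0. *)
  have := Geta (N p *m F q); rewrite FF eta0 /G inner0r (hyp_unit hM).
  by move/eqP; rewrite oner_eq0.
have key x z : tangent_to i p x -> tangent_to i p z -> G x eta = 0 -> G z eta = 0 ->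
    G x (z *m F q) = 0.
  move=> tx tz x0 z0.
  have [a [b [sa sb ap ab coordE]]] := adapted_charts hM p.
  have [X [sX Xp tX]] := exists_tangent_vfield sa sb ab coordE ap tx.
  have [Y [sY Yp tY]] := exists_tangent_vfield sa sb ab coordE ap teta.
  have [Z [sZ Zp tZ]] := exists_tangent_vfield sa sb ab coordE ap tz.
  have := inner_normal_tangent hM
    (tangent_curvature hM hgeodesic hD tD sX sY sZ tX tY tZ).
  (* In the normal component of R(x, eta)z, the terms along x and eta vanish by tangency, and those
     along Fx and Fz because <N, Fu> = <u, eta>. Only -c <x, Fz> <eta, eta> is left. *)
  rewrite hcurv//= /tensor_app Xp Yp Zp -/q -/G.
  rewrite /G !(innerZr, innerDr, innerNr) -/G !Geta x0 z0.
  rewrite (inner_normal_tangent hM tx : G _ _ = 0).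
  rewrite (inner_normal_tangent hM teta : G _ _ = 0).
  rewrite !mulr0 oppr0 !add0r addr0 => /eqP.
  by rewrite mulf_eq0 (negbTE c0) /= oppr_eq0 mulf_eq0 (negbTE GG) orbF => /eqP.
have [x x0 [xN xeta]] := exists_orthogonal_pair hn gt q (N p) eta.
rewrite -/G in xN xeta.
have tx : tangent_to i p x by apply: (tangent_to_orthogonal hM); rewrite -/q -/G Gsym.
pose y := x *m F q.
have ty : tangent_to i p y by apply: (tangent_to_orthogonal hM); rewrite -/q -/G Geta.
(* With this coefficient [w] is the part of Fx orthogonal to eta. By [key] it is orthogonal to Fx as
   well, so <w, w> = 0. *)
pose a := G y eta / G eta eta.
pose w := y - a *: eta.
have tw : tangent_to i p w.
  by rewrite /w addrC -scaleNr; exact: (tangent_toPl hM).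
have weta : G eta w = 0 by rewrite /G innerBr innerZr -/G divfK// (Gsym y) subrr.
have ww : G w w = 0.
  rewrite {2}/w /G innerBr innerZr -/G (Gsym w eta) weta mulr0 subr0.
  by apply: key => //; rewrite Gsym.
have w0 : w = 0.
  apply/eqP; apply: contraTT (lexx (0 : R)) => /(Defs.metric_pos hg q).
  by rewrite -/G ww ltxx.
have yE : y = a *: eta by apply/eqP; rewrite -subr_eq0 -/w w0.
have xE : x = a *: (eta *m F q) by rewrite -[LHS]FF -/y yE scalemxAl.
have a0 : a = 0.
  (* Pairing x = a F(eta) with the normal gives 0 = a <eta, eta>. *)
  move: xN; rewrite xE Gsym /G innerZr -/G Geta => /eqP.
  by rewrite mulf_eq0 (negbTE GG) orbF => /eqP.
by move: x0; rewrite xE a0 scale0r eqxx.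
Qed.
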